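(* Let $X$ be a diffeological space. The identity map $\mathrm{id}:\mathfrak{P}_{s}(X)\rightarrow \mathfrak{P}_{u}(X)$ is smooth. That is, the strong power set diffeology is finer than (i.e. contained in) the union power set diffeology.
   Context: A parametrization in a set $X$ is a map $P:U\to X$ with $U$ an open subset of some $\mathbb{R}^n$ ($n\ge 0$). A diffeology on $X$ is a set of parametrizations in $X$ (called plots) that contains all constant parametrizations, is local, and is stable under precomposition with smooth maps between open subsets of Euclidean spaces. A map $f$ between diffeological spaces is smooth if $f\circ P$ is a plot for every plot $P$. Let $\mathcal{D}$ be the diffeology of $X$. A smooth family of plots in $X$ (a plot of the standard functional diffeology on $\mathcal{D}$) is a map $\rho:U\to\mathcal{D}$, $U$ open in a Euclidean space, such that for all $r_0\in U$ and all $s_0\in\mathrm{dom}(\rho(r_0))$ there exist an open neighborhood $V\subset U$ of $r_0$ and an open neighborhood $W$ of $s_0$ (in the Euclidean space containing $\mathrm{dom}(\rho(r_0))$) such that $W\subset\mathrm{dom}(\rho(r))$ for all $r\in V$ and $(r,s)\mapsto\rho(r)(s)$, defined on $V\times W$, is a plot in $X$. $\mathfrak{P}(X)$ is the set of all subsets of $X$. Strong power set diffeology: $P:U\to\mathfrak{P}(X)$ is a plot of $\mathfrak{P}_s(X)$ iff for every $r_0\in U$ and every plot $Q_0$ in $X$ with $\mathrm{Im}(Q_0)\subset P(r_0)$, there exist an open neighborhood $V\subset U$ of $r_0$ and a smooth family $\sigma:V\to\mathcal{D}$ of plots in $X$ such that $\mathrm{Im}(\sigma(r))\subset P(r)$ for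 every $r\in V$ and $\sigma(r_0)=Q_0$. Union power set diffeology: $P:U\to\mathfrak{P}(X)$ is a plot of $\mathfrak{P}_u(X)$ iff there is a family of parametrizations $P_i:U_i\to\mathfrak{P}(X)$ ($i\in J$, $U_i$ open in the same Euclidean space, $U=\bigcup_i U_i$), each either constant with value $\emptyset$ or of the form $r\mapsto\{p_i(r)\}$ for a plot $p_i:U_i\to X$, such that $P(r)=\bigcup\{P_i(r)\mid i\in J,\ r\in U_i\}$ for all $r\in U$. Equivalently: for every $r_0\in U$ and $x_0\in P(r_0)$ there exist an open neighborhood $V\subset U$ of $r_0$ and a plot $\sigma:V\to X$ with $\sigma(r)\in P(r)$ for all $r\in V$ and $\sigma(r_0)=x_0$. *)

(* Defs.v *)
From HB Require Import structures.
From mathcomp Require Import all_boot all_order all_algebra.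
From mathcomp Require Import all_classical all_reals all_analysis.
Set Implicit Arguments.
Unset Strict Implicit.
Unset Printing Implicit Defensive.
Import Order.TTheory GRing.Theory Num.Theory.
Import numFieldNormedType.Exports.
Local Open Scope classical_set_scope.
Local Open Scope ring_scope.

(* f is of class C^k on U. Only the germs of f at the points of U matter when
   U is open. *)
Fixpoint Ck_on (R : realType) (m n k : nat) (U : set 'rV[R]_m)
    (f : 'rV[R]_m -> 'rV[R]_n) : Prop :=
  match k with
  | 0%N => forall x, U x -> {for x, continuous f}
  | k'.+1 => (forall x, U x -> differentiable f x) /\
             (forall v, Ck_on k' U ('D_v f))
  end.

Definition smooth_on (R : realType) (m n : nat) (U : set 'rV[R]_m)
    (f : 'rV[R]_m -> 'rV[R]_n) : Prop := forall k, Ck_on k U f.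

(* A map U -> X with U open in R^n is encoded as a partial function, so that
   Leibniz equality is equality of domains and of values. *)
Record nparam (R : realType) (X : Type) (n : nat) := NParam {
  nfun :> 'rV[R]_n -> option X ;
  nfun_open : open [set r | isSome (nfun r)] }.
Arguments nfun_open {R X n} P : rename.

Definition pdom (R : realType) (X : Type) (n : nat) (P : nparam R X n) :
  set 'rV[R]_n := [set r | isSome (P r)].

Definition pim (R : realType) (X : Type) (n : nat) (P : nparam R X n) :
  set X := [set x | exists r, P r = Some x].

(* In plot_local, Q is the restriction of P to the open neighbourhood pdom Q of
   r0; in plot_comp, Q is the composite of P with F : pdom Q -> pdom P. *)
Record diffeology (R : realType) (X : Type) := Diffeology {
  plot : forall n, nparam R X n -> Prop ;
  plot_cst : forall n (P : nparam R X n) (a : X),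
    (forall r, pdom P r -> P r = Some a) -> plot P ;
  plot_local : forall n (P : nparam R X n),
    (forall r0, pdom P r0 -> exists Q : nparam R X n,
       [/\ plot Q, pdom Q r0 & forall r, pdom Q r -> P r = Q r]) ->
    plot P ;
  plot_comp : forall m n (P : nparam R X n) (Q : nparam R X m)
      (F : 'rV[R]_m -> 'rV[R]_n),
    plot P -> smooth_on (pdom Q) F ->
    (forall r, pdom Q r -> Q r = P (F r)) ->
    plot Q }.

Definition diffeo_smooth (R : realType) (X Y : Type) (DX : diffeology R X)
    (DY : diffeology R Y) (f : X -> Y) : Prop :=
  forall n (P : nparam R X n) (Q : nparam R Y n),
    plot DX P -> (forall r, Q r = omap f (P r)) -> plot DY Q.

Definition finer (R : realType) (X : Type) (D D' : diffeology R X) : Prop :=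
  forall n (P : nparam R X n), plot D P -> plot D' P.

Definition param (R : realType) (X : Type) := {n : nat & nparam R X n}.

Definition is_plot (R : realType) (X : Type) (D : diffeology R X)
  (Q : param R X) : Prop := plot D (projT2 Q).

(* The value Q(s), for s in a Euclidean space R^n which need not be the one
   containing the domain of Q; None when s is not in that domain. *)
Definition value (R : realType) (X : Type) (Q : param R X) (n : nat)
    (s : 'rV[R]_n) : option X :=
  match projT1 Q =P n with
  | ReflectT e => projT2 Q (castmx (erefl, esym e) s)
  | ReflectF _ => None
  end.

(* rho : U -> D is a plot of the standard functional diffeology on the set D of
   plots of X; the values of rho outside U are irrelevant. R^m x R^n is
   identified with R^(m + n) by row_mx, and G is the map (r, s) |-> rho(r)(s)
   on V x W. *)
Definition smooth_family (R : realType) (X : Type) (D : diffeology R X)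
    (m : nat) (U : set 'rV[R]_m) (rho : 'rV[R]_m -> param R X) : Prop :=
  [/\ open U,
      forall r, U r -> is_plot D (rho r)
    & forall r0, U r0 ->
      forall s0 : 'rV[R]_(projT1 (rho r0)), pdom (projT2 (rho r0)) s0 ->
      exists V : set 'rV[R]_m, exists W : set 'rV[R]_(projT1 (rho r0)),
      [/\ [/\ open V, V r0 & V `<=` U],
          open W /\ W s0,
          forall r s, V r -> W s -> isSome (value (rho r) s)
        & exists G : nparam R X (m + projT1 (rho r0)),
          [/\ plot D G,
              forall r s, pdom G (row_mx r s) <-> V r /\ W s
            & forall r s, V r -> W s -> G (row_mx r s) = value (rho r) s]]].

Definition strong_plot (R : realType) (X : Type) (D : diffeology R X) (n : nat)
    (P : nparam R (set X) n) : Prop :=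
  forall r0 A0 (Q0 : param R X),
    P r0 = Some A0 -> is_plot D Q0 -> pim (projT2 Q0) `<=` A0 ->
    exists V : set 'rV[R]_n, exists sigma : 'rV[R]_n -> param R X,
    [/\ [/\ open V, V r0 & V `<=` pdom P],
        smooth_family D V sigma,
        forall r A, V r -> P r = Some A -> pim (projT2 (sigma r)) `<=` A
      & sigma r0 = Q0].

Definition union_plot (R : realType) (X : Type) (D : diffeology R X) (n : nat)
    (P : nparam R (set X) n) : Prop :=
  exists (J : Type) (P_ : J -> nparam R (set X) n),
  [/\ forall i,
        (forall r, pdom (P_ i) r -> P_ i r = Some set0) \/
        (exists p : nparam R X n,
           plot D p /\ forall r, P_ i r = omap (fun x => [set x]) (p r)),
      pdom P = \bigcup_i pdom (P_ i)
    & forall r, pdom P r ->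
        P r = Some [set x | exists i A, P_ i r = Some A /\ A x]].

Section smooth_on_theory.
Variable R : realType.
Implicit Types m n p k : nat.

Lemma Ck_onS m n k (U V : set 'rV[R]_m) (f : 'rV[R]_m -> 'rV[R]_n) :
  V `<=` U -> Ck_on k U f -> Ck_on k V f.
Proof.
move=> VU; elim: k f => [|k IH] f /=; first by move=> h x /VU /h.
by case=> h1 h2; split=> [x /VU /h1//|v]; apply: IH.
Qed.

Lemma smooth_onS m n (U V : set 'rV[R]_m) (f : 'rV[R]_m -> 'rV[R]_n) :
  V `<=` U -> smooth_on U f -> smooth_on V f.
Proof. by move=> VU h k; apply: Ck_onS (h k). Qed.

Lemma near_eq_differentiable m n (f g : 'rV[R]_m -> 'rV[R]_n) x :
  {near x, f =1 g} -> differentiable f x -> differentiable g x.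
Proof.
move=> fg df.
have fgx : f x = g x := nbhs_singleton fg.
have key : g \o shift x = cst (g x) + 'd f x +o_ 0 id.
  apply/eqaddoP => e e0.
  have /diff_locally /eqaddoP /(_ e e0) h := df.
  have fg0 : \forall h \near (0 : 'rV[R]_m), f (h + x) = g (h + x).
    by move/nbhs0P: fg; apply: filterS => y; rewrite addrC.
  near=> y.
  have -> : (g \o shift x - (cst (g x) + 'd f x)) y =
      (f \o shift x - (cst (f x) + 'd f x)) y.
    rewrite !fctE /= fgx; congr (_ - _).
    by apply/esym; near: y.
  by near: y.
have cdf : continuous ('d f x) by exact: diff_continuous.
have dgf : 'd g x = 'd f x :> (_ -> _) by exact: diff_unique.
by apply/diff_locallyP; rewrite dgf.
Unshelve. all: by end_near. Qed.

Lemma near_eq_continuous m n (f g : 'rV[R]_m -> 'rV[R]_n) x :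
  {near x, f =1 g} -> {for x, continuous f} -> {for x, continuous g}.
Proof.
move=> fg cf; have fgx : f x = g x := nbhs_singleton fg.
rewrite /prop_for /continuous_at -fgx.
exact: cvg_trans (near_eq_cvg fg) cf.
Qed.

Lemma Ck_on_eq m n k (U : set 'rV[R]_m) (f g : 'rV[R]_m -> 'rV[R]_n) :
  open U -> (forall x, U x -> f x = g x) -> Ck_on k U f -> Ck_on k U g.
Proof.
move=> oU.
have nr (f' g' : 'rV[R]_m -> 'rV[R]_n) x :
    (forall x, U x -> f' x = g' x) -> U x -> {near x, f' =1 g'}.
  by move=> fg Ux; apply: filterS (open_nbhs_nbhs (conj oU Ux)).
elim: k f g => [|k IH] f g fg /=.
  by move=> h x Ux; apply: near_eq_continuous (h _ Ux); exact: nr.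
case=> h1 h2; split=> [x Ux|v].
  by apply: near_eq_differentiable (h1 _ Ux); exact: nr.
apply: (IH ('D_v f)) => // x Ux.
by apply: near_eq_derive; exact: nr.
Qed.

Lemma Ck_on_cst m n k (U : set 'rV[R]_m) (a : 'rV[R]_n) :
  Ck_on k U (cst a).
Proof.
elim: k a => [|k IH] a /=; first by move=> x _; exact: cst_continuous.
split=> [x _|v]; first exact: differentiable_cst.
by rewrite (_ : 'D_v _ = cst 0) //; apply/funext => x; rewrite derive_cst.
Qed.

Lemma Ck_on_add m n k (U : set 'rV[R]_m) (f g : 'rV[R]_m -> 'rV[R]_n) :
  open U -> Ck_on k U f -> Ck_on k U g -> Ck_on k U (f \+ g).
Proof.
move=> oU; elim: k f g => [|k IH] f g /=.
  by move=> hf hg x Ux; apply: continuousD; [exact: hf|exact: hg].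
move=> [hf hf'] [hg hg']; split=> [x Ux|v].
  by apply: differentiableD; [exact: hf|exact: hg].
apply: (@Ck_on_eq _ _ _ _ ('D_v f \+ 'D_v g)) => //; last exact: IH.
by move=> x Ux /=; rewrite -deriveD //; apply: diff_derivable; auto.
Qed.

Lemma Ck_on_linear m n k (U : set 'rV[R]_m)
    (L : {linear 'rV[R]_m -> 'rV[R]_n}) :
  continuous L -> Ck_on k U L.
Proof.
move=> cL; case: k => [|k] /=; first by move=> x _; exact: cL.
split=> [x _|v]; first exact: linear_differentiable.
rewrite (_ : 'D_v _ = cst (L v)); first exact: Ck_on_cst.
apply/funext => x; rewrite deriveE; last exact: linear_differentiable.
by rewrite diff_lin.
Qed.

Lemma Ck_on_linearl m n p k (U : set 'rV[R]_m) (f : 'rV[R]_m -> 'rV[R]_n)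
    (L : {linear 'rV[R]_n -> 'rV[R]_p}) :
  open U -> continuous L -> Ck_on k U f -> Ck_on k U (L \o f).
Proof.
move=> oU cL; elim: k f => [|k IH] f /=.
  by move=> h x Ux; apply: continuous_comp; [exact: h|exact: cL].
case=> h1 h2.
have dL y : differentiable L y by exact: linear_differentiable.
split=> [x Ux|v]; first by apply: differentiable_comp => //; exact: h1.
apply: (@Ck_on_eq _ _ _ _ (L \o 'D_v f)) => //; last exact: IH.
move=> x Ux /=; have dfx := h1 _ Ux.
rewrite deriveE // [RHS]deriveE; last exact: differentiable_comp.
have dLE y : 'd L y = L :> (_ -> _) by exact: diff_lin.
by rewrite [in RHS]diff_comp //= dLE.
Qed.

Lemma Ck_on_linearr m n p k (U : set 'rV[R]_n) (f : 'rV[R]_n -> 'rV[R]_p)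
    (L : {linear 'rV[R]_m -> 'rV[R]_n}) :
  open U -> continuous L -> Ck_on k U f -> Ck_on k (L @^-1` U) (f \o L).
Proof.
move=> oU cL; elim: k f => [|k IH] f /=.
  by move=> h x Ux; apply: continuous_comp; [exact: cL|exact: h].
case=> h1 h2.
have dL y : differentiable L y by exact: linear_differentiable.
have oLU : open (L @^-1` U) by apply: open_comp => // x _; exact: cL.
split=> [x Ux|v]; first by apply: differentiable_comp => //; exact: h1.
apply: (@Ck_on_eq _ _ _ _ ('D_(L v) f \o L)) => //; last exact: IH.
move=> x Ux /=; have dfx := h1 _ Ux.
rewrite deriveE // [RHS]deriveE; last exact: differentiable_comp.
have dLE y : 'd L y = L :> (_ -> _) by exact: diff_lin.
by rewrite [in RHS]diff_comp //= dLE.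
Qed.

Lemma smooth_on_continuous m n (U : set 'rV[R]_m) (f : 'rV[R]_m -> 'rV[R]_n) x :
  smooth_on U f -> U x -> {for x, continuous f}.
Proof. by move=> /(_ 0%N); apply. Qed.

Lemma open_setI_preimage m n (U : set 'rV[R]_m) (V : set 'rV[R]_n)
    (f : 'rV[R]_m -> 'rV[R]_n) :
  open U -> open V -> smooth_on U f -> open (U `&` f @^-1` V).
Proof.
move=> oU oV sf; rewrite openE => x [Ux Vx]; apply: filterI.
  exact: open_nbhs_nbhs.
apply: (smooth_on_continuous sf Ux).
exact: open_nbhs_nbhs.
Qed.

Lemma smooth_on_rsubmx m n (U : set 'rV[R]_(m + n)) :
  smooth_on U (rsubmx : 'rV[R]_(m + n) -> 'rV[R]_n).
Proof. by move=> k; apply: Ck_on_linear; exact: continuous_rsubmx. Qed.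

Lemma mx_continuous (T : topologicalType) m n (f : T -> 'M[R]_(m, n)) :
  (forall i j, continuous (fun x => f x i j)) -> continuous f.
Proof.
move=> cf x B /= [P Pnbhs PB].
suff : \forall y \near x, forall i j, P i j (f y i j).
  by apply: filterS => y Py; apply: PB.
by apply: filter_forall => i; apply: filter_forall => j; apply: cf; exact: Pnbhs.
Qed.

Lemma smooth_on_row_mx m n p (U : set 'rV[R]_m) (f : 'rV[R]_m -> 'rV[R]_n) :
  open U -> smooth_on U f ->
  smooth_on (lsubmx @^-1` U)
    (fun z : 'rV[R]_(m + p) => row_mx (f (lsubmx z)) (rsubmx z)).
Proof.
move=> oU sf k.
have lin1 : linear (fun u : 'rV[R]_n => row_mx u (0 : 'rV[R]_p)).
  by move=> a u v; rewrite scale_row_mx add_row_mx scaler0 addr0.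
have lin2 : linear (fun z : 'rV[R]_(m + p) => row_mx (0 : 'rV[R]_n) (rsubmx z)).
  by move=> a u v; rewrite scale_row_mx add_row_mx scaler0 addr0 linearP.
pose L1 : {linear 'rV[R]_n -> 'rV[R]_(n + p)} :=
  HB.pack (fun u => row_mx u 0) (GRing.isLinear.Build _ _ _ _ _ lin1).
pose L2 : {linear 'rV[R]_(m + p) -> 'rV[R]_(n + p)} :=
  HB.pack (fun z => row_mx 0 (rsubmx z)) (GRing.isLinear.Build _ _ _ _ _ lin2).
have cl : continuous (lsubmx : 'rV[R]_(m + p) -> 'rV[R]_m).
  exact: continuous_lsubmx.
have olU : open ((lsubmx : 'rV[R]_(m + p) -> 'rV[R]_m) @^-1` U).
  by apply: open_comp => // x _; exact: cl.
have c1 : continuous L1.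
  apply: mx_continuous => i j u; rewrite /L1 /=; case: (splitP j) => j' jj'.
    rewrite (_ : (fun _ => _) = (fun u : 'rV[R]_n => u i j')).
      exact: coord_continuous.
    apply/funext => v; rewrite (_ : j = lshift p j') ?row_mxEl//.
    exact: val_inj.
  rewrite (_ : (fun _ => _) = cst 0); first exact: cst_continuous.
  apply/funext => v; rewrite (_ : j = rshift n j') ?row_mxEr ?mxE//.
  exact: val_inj.
have c2 : continuous L2.
  apply: mx_continuous => i j u; rewrite /L2 /=; case: (splitP j) => j' jj'.
    rewrite (_ : (fun _ => _) = cst 0); first exact: cst_continuous.
    apply/funext => v; rewrite (_ : j = lshift p j') ?row_mxEl ?mxE//.
    exact: val_inj.
  rewrite (_ : (fun _ => _) = (fun u : 'rV[R]_(m + p) => u i (rshift m j'))).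
    exact: coord_continuous.
  apply/funext => v; rewrite (_ : j = rshift n j') ?row_mxEr ?mxE//.
  exact: val_inj.
rewrite (_ : (fun _ => _) = (L1 \o (f \o lsubmx)) \+ L2); last first.
  by apply/funext => z; rewrite /L1 /L2 /= add_row_mx addr0 add0r.
apply: Ck_on_add => //; last exact: Ck_on_linear.
apply: Ck_on_linearl => //.
exact: (@Ck_on_linearr _ _ _ _ _ _ (lsubmx : {linear 'rV[R]_(m + p) -> 'rV[R]_m})).
Qed.

End smooth_on_theory.

Section powerset_diffeologies.
Variables (R : realType) (X : Type).
Implicit Types (D : diffeology R X) (m n : nat).

Lemma pdom_open (Y : Type) n (P : nparam R Y n) : open (pdom P).
Proof. exact: (nfun_open P). Qed.
Arguments pdom_open {Y n} P.

Lemma plot_pullback D m n (P : nparam R X n) (U : set 'rV[R]_m)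
    (F : 'rV[R]_m -> 'rV[R]_n) :
  open U -> smooth_on U F -> plot D P ->
  exists Q : nparam R X m,
    [/\ plot D Q,
        forall r, pdom Q r <-> U r /\ pdom P (F r)
      & forall r, U r -> Q r = P (F r)].
Proof.
move=> oU sF plP.
pose q r := if `[< U r >] then P (F r) else None.
have qU r : U r -> q r = P (F r) by move=> Ur; rewrite /q asboolT.
have qE : [set r | isSome (q r)] = U `&` F @^-1` pdom P.
  apply/seteqP; split=> r; rewrite /pdom /=.
    by rewrite /q; case: asboolP.
  by case=> Ur; rewrite qU.
have oq : open [set r | isSome (q r)].
  by rewrite qE; apply: open_setI_preimage => //; exact: pdom_open.
have dq r : pdom (NParam oq) r <-> U r /\ pdom P (F r).
  rewrite /pdom /=; split; first by rewrite /q; case: asboolP.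
  by case=> Ur; rewrite qU.
exists (NParam oq); split => //.
apply: (plot_comp plP (F := F)); first by apply: smooth_onS sF => r /dq[].
by move=> r /dq[Ur _]; exact: qU.
Qed.

Lemma valueE (Q : param R X) (s : 'rV[R]_(projT1 Q)) :
  value Q s = projT2 Q s.
Proof. by rewrite /value; case: eqP => // e; rewrite castmx_id. Qed.

Lemma smooth_family_cst D m (U : set 'rV[R]_m) (Q : param R X) :
  open U -> is_plot D Q -> smooth_family D U (fun=> Q).
Proof.
move=> oU plQ; split=> // r0 Ur0 s0 Qs0.
exists U, (pdom (projT2 Q)); split=> //.
- by split=> //; exact: subset_refl.
- by split=> //; exact: pdom_open.
- by move=> r s _; rewrite valueE.
have oU' : open ((lsubmx : 'rV[R]_(m + projT1 Q) -> 'rV[R]_m) @^-1` U).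
  by apply: open_comp => // x _; exact: continuous_lsubmx.
have [G [plG dG GE]] := plot_pullback oU' (@smooth_on_rsubmx _ _ _ _) plQ.
exists G; split=> // [r s|r s Vr Ws].
  by rewrite dG /= row_mxKl row_mxKr.
by rewrite GE /= ?row_mxKl// row_mxKr valueE.
Qed.

Lemma smooth_family_comp D m n (U : set 'rV[R]_n) (U' : set 'rV[R]_m)
    (F : 'rV[R]_m -> 'rV[R]_n) (rho : 'rV[R]_n -> param R X) :
  open U' -> smooth_on U' F -> (forall r, U' r -> U (F r)) ->
  smooth_family D U rho -> smooth_family D U' (rho \o F).
Proof.
move=> oU' sF UF [oU plrho famrho]; split=> // [r /UF /plrho//|r0 Ur0 s0 ds0].
have [V [W [[oV Vr0 VU] [oW Ws0] VW [G [plG dG GE]]]]] :=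
  famrho _ (UF _ Ur0) _ ds0.
exists (U' `&` F @^-1` V), W; split=> //.
- by split=> [||r []//]; [exact: open_setI_preimage|split].
- by move=> r s [_ Vr] Ws; exact: VW.
have oU2 : open ((lsubmx : 'rV[R]_(m + projT1 (rho (F r0))) -> 'rV[R]_m) @^-1` U').
  by apply: open_comp => // x _; exact: continuous_lsubmx.
have [G' [plG' dG' GE']] := plot_pullback oU2
  (@smooth_on_row_mx _ _ _ (projT1 (rho (F r0))) _ _ oU' sF) plG.
exists G'; split=> // [r s|r s [Ur Vr] Ws].
  rewrite dG' /= row_mxKl row_mxKr; split.
    by case=> Ur /dG[].
  by case=> -[Ur Vr] Ws; split=> //; apply/dG.
by rewrite GE' /= ?row_mxKl// row_mxKr GE.
Qed.

Lemma strong_plot_cst D n (P : nparam R (set X) n) (A : set X) :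
  (forall r, pdom P r -> P r = Some A) -> strong_plot D P.
Proof.
move=> PA r0 A0 Q0 Pr0 plQ0 imQ0.
have dP r B : P r = Some B -> B = A.
  by move=> PB; have := PA r; rewrite /pdom /= PB => /(_ isT) [].
exists (pdom P), (fun=> Q0); split=> //.
- by split=> //; [exact: pdom_open|rewrite /pdom /= Pr0].
- by apply: smooth_family_cst => //; exact: pdom_open.
- by move=> r B _ /dP ->; rewrite -(dP _ _ Pr0).
Qed.

Lemma strong_plot_local D n (P : nparam R (set X) n) :
  (forall r0, pdom P r0 -> exists Q : nparam R (set X) n,
     [/\ strong_plot D Q, pdom Q r0 & forall r, pdom Q r -> P r = Q r]) ->
  strong_plot D P.
Proof.
move=> locP r0 A0 Q0 Pr0 plQ0 imQ0.
have [|Q [plQ Qr0 PQ]] := locP r0; first by rewrite /pdom /= Pr0.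
have [|V [sigma [[oV Vr0 VQ] fam sim s0]]] := plQ r0 A0 Q0 _ plQ0 imQ0.
  by rewrite -PQ.
exists V, sigma; split=> //.
- by split=> // r /VQ Qr; rewrite /pdom /= PQ.
- by move=> r A Vr PA; apply: sim => //; rewrite -PQ //; exact: VQ.
Qed.

Lemma strong_plot_comp D m n (P : nparam R (set X) n) (Q : nparam R (set X) m)
    (F : 'rV[R]_m -> 'rV[R]_n) :
  strong_plot D P -> smooth_on (pdom Q) F ->
  (forall r, pdom Q r -> Q r = P (F r)) -> strong_plot D Q.
Proof.
move=> plP sF QF r0 A0 Q0 Qr0 plQ0 imQ0.
have dr0 : pdom Q r0 by rewrite /pdom /= Qr0.
have [|V [sigma [[oV Vr0 VP] fam sim s0]]] := plP (F r0) A0 Q0 _ plQ0 imQ0.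
  by rewrite -QF.
have oQ : open (pdom Q) by exact: pdom_open.
have oV' := open_setI_preimage oQ oV sF.
exists (pdom Q `&` F @^-1` V), (sigma \o F); split=> //.
- apply: smooth_family_comp fam => //; last by move=> r [].
  by apply: smooth_onS sF => r [].
- by move=> r A [Qr Vr] QA; apply: sim => //; rewrite -QF.
Qed.

Lemma union_plotP D n (P : nparam R (set X) n) :
  union_plot D P <->
  (forall r0 A x0, P r0 = Some A -> A x0 -> exists p : nparam R X n,
     [/\ plot D p, p r0 = Some x0
       & forall r x, p r = Some x -> exists2 B, P r = Some B & B x]).
Proof.
split=> [[J [P_ [okP dP PE]]] r0 A x0 Pr0 Ax0|h].
  have := PE r0; rewrite /pdom /= Pr0 => /(_ isT) [AE].
  move: Ax0; rewrite AE => -[i [B [Pi Bx0]]].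
  case: (okP i) => [/(_ r0)|[p [plp pE]]].
    by rewrite /pdom /= Pi => /(_ isT) [B0]; move: Bx0; rewrite B0.
  exists p; split=> // [|r x px].
    move: Pi; rewrite pE; case: (p r0) => //= y [yB].
    by move: Bx0; rewrite -yB => ->.
  have Pir : P_ i r = Some [set x] by rewrite pE px.
  have Pr : pdom P r by rewrite dP; exists i => //; rewrite /pdom /= Pir.
  rewrite (PE _ Pr); eexists; first by [].
  by exists i, [set x].
pose ok (Q : nparam R (set X) n) :=
  (forall r, pdom Q r -> Q r = Some set0) \/
  (exists p : nparam R X n,
     plot D p /\ forall r, Q r = omap (fun x => [set x]) (p r)).
pose sub (Q : nparam R (set X) n) :=
  forall r B, Q r = Some B -> exists2 A, P r = Some A & B `<=` A.
exists {Q | ok Q /\ sub Q}, (fun Q => sval Q); split=> [[Q []]//||].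
  apply/seteqP; split=> [r Pr|r [[Q [okQ subQ]] _]]; last first.
    rewrite /pdom /=; case E: (Q r) => [B|//] _.
    by have [A -> _] := subQ _ _ E.
  pose q r := omap (fun _ : set X => set0 : set X) (P r).
  have oq : open [set r | isSome (q r)].
    have := nfun_open P; congr open; apply/seteqP.
    by split=> s /=; rewrite /q; case: (P s).
  have okq : ok (NParam oq).
    by left=> s; rewrite /pdom /= /q; case: (P s).
  have subq : sub (NParam oq).
    by move=> s B /=; rewrite /q; case: (P s) => //= A [<-]; exists A.
  exists (exist (fun Q => ok Q /\ sub Q) _ (conj okq subq)) => //=.
  by move: Pr; rewrite /pdom /= /q; case: (P r).
move=> r; rewrite /pdom /=; case E: (P r) => [A|//] _; congr Some.
apply/seteqP; split=> [x Ax|x [[Q [okQ subQ]] /= [B [QB Bx]]]]; last first.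
  by have [A'] := subQ _ _ QB; rewrite E => -[->]; apply.
have [p [plp pr pP]] := h _ _ _ E Ax.
pose q r := omap (fun x => [set x] : set X) (p r).
have oq : open [set r | isSome (q r)].
  have := nfun_open p; congr open; apply/seteqP.
  by split=> s /=; rewrite /q; case: (p s).
have okq : ok (NParam oq) by right; exists p.
have subq : sub (NParam oq).
  move=> s B /=; rewrite /q; case E': (p s) => [y|//] /= [<-].
  by have [A' -> A'y] := pP _ _ E'; exists A' => // z ->.
exists (exist (fun Q => ok Q /\ sub Q) _ (conj okq subq)), [set x] => /=.
by rewrite /q pr.
Qed.

Lemma union_plot_cst D n (P : nparam R (set X) n) (A : set X) :
  (forall r, pdom P r -> P r = Some A) -> union_plot D P.
Proof.
move=> PA; apply/union_plotP => r0 A0 x0 Pr0 Ax0.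
have dP r B : P r = Some B -> B = A.
  by move=> PB; have := PA r; rewrite /pdom /= PB => /(_ isT) [].
pose q r := omap (fun _ : set X => x0) (P r).
have oq : open [set r | isSome (q r)].
  have := nfun_open P; congr open; apply/seteqP.
  by split=> s /=; rewrite /q; case: (P s).
exists (NParam oq); split=> /=.
- apply: (@plot_cst _ _ D _ _ x0) => r; rewrite /pdom /= /q.
  by case: (P r).
- by rewrite /q Pr0.
- move=> r x; rewrite /q; case E: (P r) => [B|//] [<-]; exists B => //.
  by rewrite (dP _ _ E) -(dP _ _ Pr0).
Qed.

Lemma union_plot_local D n (P : nparam R (set X) n) :
  (forall r0, pdom P r0 -> exists Q : nparam R (set X) n,
     [/\ union_plot D Q, pdom Q r0 & forall r, pdom Q r -> P r = Q r]) ->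
  union_plot D P.
Proof.
move=> locP; apply/union_plotP => r0 A x0 Pr0 Ax0.
have [|Q [/union_plotP plQ Qr0 PQ]] := locP r0; first by rewrite /pdom /= Pr0.
have [|p [plp pr0 pQ]] := plQ r0 A x0 _ Ax0; first by rewrite -PQ.
exists p; split=> // r x /pQ[B QB Bx]; exists B => //.
by rewrite PQ // /pdom /= QB.
Qed.

Lemma union_plot_comp D m n (P : nparam R (set X) n) (Q : nparam R (set X) m)
    (F : 'rV[R]_m -> 'rV[R]_n) :
  union_plot D P -> smooth_on (pdom Q) F ->
  (forall r, pdom Q r -> Q r = P (F r)) -> union_plot D Q.
Proof.
move=> /union_plotP plP sF QF; apply/union_plotP => r0 A x0 Qr0 Ax0.
have dr0 : pdom Q r0 by rewrite /pdom /= Qr0.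
have [|p [plp pr0 pP]] := plP (F r0) A x0 _ Ax0; first by rewrite -QF.
have oQ : open (pdom Q) by exact: pdom_open.
have [q [plq dq qE]] := plot_pullback oQ sF plp.
exists q; split=> // [|r x qr]; first by rewrite qE.
have /dq[Qr _] : pdom q r by rewrite /pdom /= qr.
by rewrite QF //; apply: pP; rewrite -qE.
Qed.

Definition strong_powerset D : diffeology R (set X) :=
  Diffeology (@strong_plot_cst D) (@strong_plot_local D) (@strong_plot_comp D).

Definition union_powerset D : diffeology R (set X) :=
  Diffeology (@union_plot_cst D) (@union_plot_local D) (@union_plot_comp D).

End powerset_diffeologies.

(* Main.v *)
From HB Require Import structures.
Require Import Defs.
From mathcomp Require Import all_boot all_order all_algebra.
From mathcomp Require Import all_classical all_reals all_analysis.
Import GRing.Theory numFieldNormedType.Exports.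
Local Open Scope classical_set_scope.
Local Open Scope ring_scope.

(** Regard a point x0 of P(r0) as a plot defined on R^0 with image inside P(r0).
    Strong smoothness extends it to a smooth family of plots sigma with images
    inside the sets P(r), and r |-> sigma(r)(0) is then a plot through x0
    selecting a point of each P(r) near r0. *)

Lemma continuous_row_mx0 (R : realType) (m p : nat) :
  continuous (fun r : 'rV[R]_m => row_mx r (0 : 'rV[R]_p)).
Proof.
apply: mx_continuous => i j; case: (split_ordP j) => k ->.
  rewrite (_ : (fun _ => _) = (fun r : 'rV[R]_m => r i k)).
    exact: coord_continuous.
  by apply/funext => r; rewrite row_mxEl.
rewrite (_ : (fun _ => _) = cst 0); first exact: cst_continuous.
by apply/funext => r; rewrite row_mxEr mxE.
Qed.

(** The slice inclusion at height [s] is affine: the linear map [r |-> (r, 0)] plus the constant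
    [(0, s)]. Precomposing with it freezes the second variable of a plot on a product. *)
Lemma smooth_on_row_mx_cst (R : realType) (m p : nat) (U : set 'rV[R]_m)
    (s : 'rV[R]_p) :
  open U -> smooth_on U (fun r : 'rV[R]_m => row_mx r s).
Proof.
move=> oU k.
have lin : linear (fun r : 'rV[R]_m => row_mx r (0 : 'rV[R]_p)).
  by move=> a u v; rewrite scale_row_mx add_row_mx scaler0 addr0.
pose L : {linear 'rV[R]_m -> 'rV[R]_(m + p)} :=
  HB.pack (fun r => row_mx r 0) (GRing.isLinear.Build _ _ _ _ _ lin).
rewrite (_ : (fun _ => _) = L \+ cst (row_mx 0 s)); last first.
  by apply/funext => r /=; rewrite add_row_mx addr0 add0r.
apply: Ck_on_add => //; last exact: Ck_on_cst.
by apply: Ck_on_linear; exact: continuous_row_mx0.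
Qed.

Lemma value_pim (R : realType) (X : Type) (Q : param R X) (n : nat)
    (s : 'rV[R]_n) (x : X) :
  value Q s = Some x -> pim (projT2 Q) x.
Proof. by rewrite /value; case: eqP => // e Qx; eexists; exact: Qx. Qed.

(** Near [(r0, s0)] the family is given by a plot [G] on [V] x [W]; its pullback along
    [r |-> (r, s0)] is the plot sought. Only [s0] is evaluated, so the point stays fixed while the
    plot [rho r] varies. *)
Lemma smooth_family_eval (R : realType) (X : Type) (D : diffeology R X)
    (m : nat) (U : set 'rV[R]_m) (rho : 'rV[R]_m -> param R X) (r0 : 'rV[R]_m)
    (s0 : 'rV[R]_(projT1 (rho r0))) (x0 : X) :
  smooth_family D U rho -> U r0 -> projT2 (rho r0) s0 = Some x0 ->
  exists p : nparam R X m,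
    [/\ plot D p, p r0 = Some x0
      & forall r x, p r = Some x -> U r /\ pim (projT2 (rho r)) x].
Proof.
move=> [oU _ fam] Ur0 rhox0.
have [|V [W [[oV Vr0 VU] [_ Ws0] _ [G [plG _ GE]]]]] := fam _ Ur0 s0.
  by rewrite /pdom /= rhox0.
have [p [plp dp pE]] :=
  plot_pullback oV (smooth_on_row_mx_cst _ _ _ _ s0 oV) plG.
exists p; split=> // [|r x px]; first by rewrite pE// GE// valueE.
have /dp[Vr _] : pdom p r by rewrite /pdom /= px.
split; first exact: VU.
by apply: value_pim; rewrite -px pE// GE.
Qed.

Lemma strong_plot_union_plot (R : realType) (X : Type) (D : diffeology R X)
    (n : nat) (P : nparam R (set X) n) :
  strong_plot D P -> union_plot D P.
Proof.
move=> sP; apply/union_plotP => r0 A x0 Pr0 Ax0.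
have oT : open [set r : 'rV[R]_0 | isSome (Some x0)].
  suff -> : [set r : 'rV[R]_0 | isSome (Some x0)] = setT by exact: openT.
  by apply/seteqP; split.
pose Q0 : param R X := existT _ 0%N (@NParam R X 0 (fun=> Some x0) oT).
have [||V [sigma [[_ Vr0 VP] fam sim sr0]]] := sP r0 A Q0 Pr0.
- exact: plot_cst.
- by move=> x [r [<-]].
(* The type of [s] depends on [sigma r0]. Quantifying over [s] before rewriting with [sigma r0 = Q0]
   avoids transporting the origin of R^0 along an equality of dimensions. *)
have [s0 s0E] : exists s, projT2 (sigma r0) s = Some x0.
  by rewrite sr0; exists 0.
have [p [plp pr0 pP]] := smooth_family_eval _ _ _ _ _ _ _ _ _ fam Vr0 s0E.
exists p; split=> // r x /pP[Vr simx].
have := VP _ Vr; rewrite /pdom /=; case E: (P r) => [B|//] _.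
by exists B => //; exact: (sim r).
Qed.

Theorem proposition4p2 (R : realType) (X : Type) (D : diffeology R X) :
  diffeo_smooth (strong_powerset D) (union_powerset D) (@id (set X)) /\
  finer (strong_powerset D) (union_powerset D).
Proof.
have fin : finer (strong_powerset D) (union_powerset D).
  by move=> n P; exact: strong_plot_union_plot.
split=> // n P Q plP QE; apply: fin.
(* [Q] and [P] agree pointwise but are distinct records carrying their own openness proofs;
   locality, with [P] itself as local model at every point, transfers the plot property. *)
apply: (@plot_local _ _ (strong_powerset D)) => r0 Qr0.
have PQ r : Q r = P r by rewrite QE; case: (P r).
by exists P; split=> //; rewrite /pdom /= -PQ.
Qed.
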